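(* Let $\mathcal H$ be a separable Hilbert space and let $S:\mathcal H\to\mathcal H$ be a bounded, self-adjoint, positive definite operator (with bounded inverse $S^{-1}$). Let $S_1,S_2:\mathcal H\to\mathcal H$ be bounded, self-adjoint and positive semidefinite with $S=S_1+S_2$. Then for any $\lambda\in\mathbb R$, $$\left(2\lambda-\frac{\lambda^2}{2}-1\right) S_1+\left(1-\frac{\lambda^2}{2}\right) S_2\le S_1S^{-1}S_1+S_2S^{-1}S_2\le S.$$
   Context: For operators $U,V:\mathcal H\to\mathcal H$, write $U\le V$ if $U,V$ are self-adjoint and $V-U$ is positive semidefinite, i.e. $\langle (V-U)f,f\rangle\ge 0$ for all $f\in\mathcal H$. Positive definite operators are understood to be boundedly invertible. Hilbert spaces are complex. *)

(* Defs.v *)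
From HB Require Import structures.
From mathcomp Require Import all_boot all_order all_algebra.
From mathcomp Require Import complex.
From mathcomp Require Import boolp classical_sets cardinality reals topology.
From mathcomp Require Import normedtype.

Set Implicit Arguments.
Unset Strict Implicit.
Unset Printing Implicit Defensive.

Import Order.TTheory GRing.Theory Num.Theory.

Local Open Scope classical_set_scope.
Local Open Scope ring_scope.

Definition separable (T : topologicalType) : Prop :=
  exists2 A : set T, countable A & dense A.

(* A complex Hilbert space is a complete normed R[i]-module [H] with a
   positive definite form [dot], linear in its first argument and
   conjugate-linear in its second, that induces the norm. Norms take their
   values in R[i], so the equation below lives in R[i]. *)
Definition induces_norm (R : realType) (H : normedModType R[i])
    (dot : {dot H for Num.conj}) : Prop :=
  forall f : H, `|f| ^+ 2 = dot f f.

Section Operators.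
Variables (R : realType) (H : normedModType R[i]) (dot : {dot H for Num.conj}).
Implicit Types S T U V : {linear H -> H}.

(* For a linear map, boundedness near 0 is boundedness of the operator: see
   [linear_boundedP]. *)
Definition bounded_operator T : Prop := bounded_near T (nbhs (0 : H)).

Definition self_adjoint T : Prop := forall f g : H, dot (T f) g = dot f (T g).

(* [0 <= z] in R[i] means that [z] is real and nonnegative. *)
Definition positive_semidefinite T : Prop := forall f : H, 0 <= dot (T f) f.

Definition bounded_inverse S T : Prop :=
  [/\ bounded_operator T, cancel S T & cancel T S].

Definition positive_definite S : Prop :=
  (forall f : H, f != 0 -> 0 < dot (S f) f) /\
  exists T, bounded_inverse S T.

Definition operator_le U V : Prop :=
  [/\ self_adjoint U, self_adjoint V & positive_semidefinite (V \- U)].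

End Operators.

(* Main.v *)
Require Import Defs.
From mathcomp Require Import all_boot all_order all_algebra.
From mathcomp Require Import complex.
From mathcomp Require Import boolp classical_sets cardinality reals topology.
From mathcomp Require Import normedtype.
From mathcomp Require Import ring.
From mathcomp Require Import ring.

Set Implicit Arguments.
Unset Strict Implicit.
Unset Printing Implicit Defensive.

Import Order.TTheory GRing.Theory Num.Theory.

Local Open Scope ring_scope.
Local Open Scope complex_scope.

(** Both inequalities come from closed formulas for the difference of the two
    sides. Put A = S1 S^-1 S1 + S2 S^-1 S2, fix a vector f, and split it as
    f = g + h with g = S^-1 S1 f and h = S^-1 S2 f.

    Upper bound. Replacing S2 by S - S1 shows that S1 S^-1 S2 and S2 S^-1 S1
    are the same operator Q = S1 - S1 S^-1 S1, and that S - A = 2 Q. Now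
    Q f = S1 h = S2 g, so pairing Q f with f = g + h gives
      <Q f, f> = <S2 g, g> + <S1 h, h>,
    a sum of two nonnegative terms ([mixed_term_symmetric],
    [mixed_term_ge0]).

    Lower bound. Put W = S1 - (lambda / 2) S. Subtracting the left-hand operator
    from A leaves exactly the completed square 2 W S^-1 W, and S^-1 is positive
    because <S^-1 w, w> = <u, S u> for u = S^-1 w. In terms of vectors, with
    u = g - (lambda / 2) f, one has S u = W f, so the quadratic form of the
    difference at f is 2 <W u, f> = 2 <u, W f> = 2 <u, S u>. *)

Section HermitianForm.
Variables (R : realType) (H : normedModType R[i]) (dot : {dot H for Num.conj}).
Implicit Types S T U V P : {linear H -> H}.

Lemma self_adjointD U V :
  self_adjoint dot U -> self_adjoint dot V -> self_adjoint dot (U \+ V).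
Proof. by move=> sU sV f g /=; rewrite linearDl linearDr /= sU sV. Qed.

Lemma self_adjointZ (a : R) T :
  self_adjoint dot T -> self_adjoint dot (a%:C \*: T).
Proof.
move=> sT f g /=; rewrite linearZl_LR linearZr_LR /= sT.
by congr (_ * _); rewrite [RHS]conjc_real.
Qed.

Lemma self_adjoint_inverse S P :
  cancel P S -> self_adjoint dot S -> self_adjoint dot P.
Proof. by move=> PK sS f g; rewrite -{1}(PK g) -sS PK. Qed.

Lemma self_adjoint_sandwich T P :
  self_adjoint dot T -> self_adjoint dot P -> self_adjoint dot (T \o P \o T).
Proof. by move=> sT sP f g /=; rewrite sT sP sT. Qed.

Lemma positive_definite_semidefinite S :
  positive_definite dot S -> positive_semidefinite dot S.
Proof.
move=> [S_gt0 _] f; have [->|/S_gt0/ltW//] := eqVneq f 0.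
by rewrite linear0r.
Qed.

End HermitianForm.

Section Splitting.
Variables (R : realType) (H : normedModType R[i]) (dot : {dot H for Num.conj}).
Variables S P S1 S2 : {linear H -> H}.
Hypotheses (SK : cancel S P) (PK : cancel P S) (S_sum : S =1 S1 \+ S2).

Lemma splitting_decomposition f : P (S1 f) + P (S2 f) = f.
Proof. by rewrite -linearD -[S1 f + S2 f]S_sum SK. Qed.

(** Both sides equal [S1 f - S1 (P (S1 f))]: replace [S2] by [S - S1] and
    cancel [S] against its inverse [P]. *)
Lemma mixed_term_symmetric f : S1 (P (S2 f)) = S2 (P (S1 f)).
Proof.
have S2E x : S2 x = S x - S1 x by rewrite S_sum /= addrC addKr.
rewrite [RHS]S2E PK; apply: (addIr (S1 (P (S1 f)))).
by rewrite subrK -linearD addrC splitting_decomposition.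
Qed.

(** A product of positive operators need not be positive, but here the two
    expressions of the same vector given by [mixed_term_symmetric] can be paired
    with the two components of [f], each giving a value of the form of [S1] or
    of [S2]. *)
Lemma mixed_term_ge0 f :
  positive_semidefinite dot S1 -> positive_semidefinite dot S2 ->
  0 <= dot (S1 (P (S2 f))) f.
Proof.
move=> S1_ge0 S2_ge0.
suff: 0 <= dot (S1 (P (S2 f))) (P (S1 f) + P (S2 f)).
  by rewrite splitting_decomposition.
rewrite linearDr {1}mixed_term_symmetric.
by apply: addr_ge0; [exact: S2_ge0 | exact: S1_ge0].
Qed.

Lemma splitting_defect f :
  S f - (S1 (P (S1 f)) + S2 (P (S2 f))) = S1 (P (S2 f)) *+ 2.
Proof.
have: S (P (S1 f) + P (S2 f)) = S f by rewrite splitting_decomposition.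
move<-; rewrite linearD !S_sum /=.
rewrite -mixed_term_symmetric [S1 (P (S2 f)) + _]addrC addrACA.
rewrite [LHS]addrAC subrr add0r.
by rewrite mulr2n.
Qed.

(** The operator paired with [f] on the left is [2 W P W], where
    [W = S1 - (lambda / 2) S]: expand the square, using
    [2 S1 P S1 = (S1 P S1 + S2 P S2) + S1 - S2]. On the right, [u = P (W f)], so
    that [S u = W f]. *)
Lemma completed_square (lambda : R) f :
  self_adjoint dot S -> self_adjoint dot S1 ->
  let u := P (S1 f) - (lambda / 2)%:C *: f in
  dot (S1 (P (S1 f)) + S2 (P (S2 f)) -
       ((2 * lambda - lambda ^+ 2 / 2 - 1)%:C *: S1 f +
        (1 - lambda ^+ 2 / 2)%:C *: S2 f)) f = 2 * dot u (S u).
Proof.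
move=> sS sS1 u.
have S2E x : S2 x = S x - S1 x by rewrite S_sum /= addrC addKr.
have PS2 : P (S2 f) = f - P (S1 f).
  by rewrite -[X in _ = X - _](splitting_decomposition f) addrC addKr.
have eq1 : dot (S1 (P (S1 f))) f = dot (P (S1 f)) (S1 f) by rewrite sS1.
have eq2 : dot f (S1 f) = dot (S1 f) f by rewrite sS1.
have eq3 : dot (P (S1 f)) (S f) = dot (S1 f) f by rewrite -sS PK.
have eq4 : dot f (S f) = dot (S f) f by rewrite sS.
have Su : S u = S1 f - (lambda / 2)%:C *: S f by rewrite linearB linearZ /= PK.
rewrite Su PS2 !S2E !(linearB S, linearB S1) /= PK.
rewrite linearBl !linearDl !linearNl !linearZl_LR /= !linearBl !linearBr /=.
have conj_half : Num.conj (lambda / 2)%:C = (lambda / 2)%:C by exact: conjc_real.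
(* The form is conjugate-linear on the right: [lambda] real is used here. *)
rewrite !linearZr_LR /= conj_half eq1 eq2 eq3 eq4.
rewrite !(rmorphB, rmorphM, rmorphXn, fmorphV, rmorph1, rmorph_nat) /=.
by field.
Qed.

End Splitting.

Theorem theorem2p8 (R : realType) (H : completeNormedModType R[i])
    (dot : {dot H for Num.conj}) (dot_norm : induces_norm dot)
    (H_separable : separable H)
    (S Sinv S1 S2 : {linear H -> H})
    (S_bounded : bounded_operator S)
    (S_self_adjoint : self_adjoint dot S)
    (S_posdef : positive_definite dot S)
    (S_inverse : bounded_inverse S Sinv)
    (S1_bounded : bounded_operator S1)
    (S1_self_adjoint : self_adjoint dot S1)
    (S1_possemidef : positive_semidefinite dot S1)
    (S2_bounded : bounded_operator S2)
    (S2_self_adjoint : self_adjoint dot S2)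
    (S2_possemidef : positive_semidefinite dot S2)
    (S_sum : S =1 S1 \+ S2)
    (lambda : R) :
  operator_le dot
    (((2 * lambda - lambda ^+ 2 / 2 - 1)%:C \*: S1) \+
     ((1 - lambda ^+ 2 / 2)%:C \*: S2))
    ((S1 \o Sinv \o S1) \+ (S2 \o Sinv \o S2)) /\
  operator_le dot
    ((S1 \o Sinv \o S1) \+ (S2 \o Sinv \o S2))
    S.
Proof.
have [_ SK PK] := S_inverse.
have sP := self_adjoint_inverse PK S_self_adjoint.
have sA : self_adjoint dot ((S1 \o Sinv \o S1) \+ (S2 \o Sinv \o S2)).
  by apply: self_adjointD; apply: self_adjoint_sandwich.
have S_ge0 := positive_definite_semidefinite S_posdef.
split; split=> //.
- by apply: self_adjointD; apply: self_adjointZ.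
- move=> f /=; rewrite (completed_square SK PK S_sum) //.
  by rewrite -S_self_adjoint mulr_ge0.
- move=> f /=; rewrite (splitting_defect SK PK S_sum) mulr2n linearDl /=.
  by rewrite addr_ge0 ?(mixed_term_ge0 SK PK S_sum).
Qed.
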